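(* Let $t_1^1,t_1^2$ be nonzero real numbers and $N\ge3$ an integer, and let $\Gamma(t_1^1,t_1^2,N)$ be the corresponding fundamental lattice of $\mathbf{Sol}$. Every lattice-like cylinder packing related to this lattice has density $$\delta\le\frac{\pi}{\sqrt{12}}\approx0.906900,$$ and every lattice-like cylinder covering related to this lattice has density $$\Delta\ge\frac{2\pi}{\sqrt{27}}\approx1.209200 .$$
   Context: $\mathbf{Sol}$ is $\mathbb R^3$ with the group law $(a,b,c)(x,y,z)=(x+ae^{-z},\,y+be^{z},\,z+c)$, and translations act on points by right multiplication. The invariant metric is $ds^2=e^{2z}dx^2+e^{-2z}dy^2+dz^2$, so that volume is the Lebesgue measure $dx\,dy\,dz$. The plane $z=0$ is called the base plane. Fundamental lattice: for real $t_1^1,t_1^2\ne0$ and an integer $N\ge3$, put $h=\log\frac{N+\sqrt{N^2-4}}{2}$. Then $\Gamma(t_1^1,t_1^2,N)$ is the subgroup generated by $\tau_1=(t_1^1,t_1^2,0)$, $\tau_2=(t_1^1e^{-h},t_1^2e^{h},0)$, $\tau_3=(0,0,h)$. Let $\Gamma^0=\{m\tau_1+n\tau_2: m,n\in\mathbb Z\}$ be its sublattice in the base plane. The fundamental parallelepiped $\mathcal P$ has base parallelogram $\mathcal P^b$ spanned by $\tau_1,\tau_2$, of area $|t_1^1t_1^2(e^h-e^{-h})|$, and $\mathrm{Vol}(\mathcal P)=h\cdot\mathrm{Area}(\mathcal P^b)$. Cylinders: $\mathcal C^i(r)=\{(x,y,z): x^2+y^2\le r^2\}$ is the infinite circular cylinder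 of radius $r$. It is bounded by the translation curves in the direction of the $z$-axis (vertical lines) through the points of the circle of radius $r$ about the origin in the base plane. For $\tau=(x^1,x^2,0)$, its translate $\mathcal C^i_\tau(r)$ is the vertical cylinder of radius $r$ over the disk centred at $(x^1,x^2)$. The bounded cylinder $\mathcal C(r,h)$ is the part $0\le z\le h$ of $\mathcal C^i(r)$, with base disk $\mathcal C^b(r)$ and volume $\pi r^2h$. Lattice-like cylinder packing (respectively covering) of radius $r>0$ related to $\Gamma(t_1^1,t_1^2,N)$: the family $\{\mathcal C^i_\tau(r):\tau\in\Gamma^0\}$ (cut into bounded cylinders of height $h$), provided that the cylinders have pairwise disjoint interiors (respectively cover $\mathbf{Sol}$). Equivalently, the disks of radius $r$ centred at the points of $\Gamma^0$ form a packing (respectively covering) of the Euclidean plane. In both cases the density is $$\frac{\mathrm{Vol}(\mathcal C(r,h))}{\mathrm{Vol}(\mathcal P)}=\frac{\mathrm{Area}(\mathcal C^b(r))}{\mathrm{Area}(\mathcal P^b)}=\frac{\pi r^2}{|t_1^1t_1^2(e^h-e^{-h})|}.$$ *)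

(* Defs.v *)
From HB Require Import structures.
From mathcomp Require Import all_boot all_order all_algebra.
From mathcomp Require Import all_classical all_reals all_analysis.
From mathcomp Require Import ring lra.
Set Implicit Arguments.
Unset Strict Implicit.
Unset Printing Implicit Defensive.
Import Order.TTheory GRing.Theory Num.Theory.
Import numFieldNormedType.Exports.
Local Open Scope classical_set_scope.
Local Open Scope ring_scope.

(* A point (x, y, z) of Sol is ((x, y), z).  Only the group law is twisted:
   the vector space, topological and measurable structures are those of R^3. *)
Notation sol R := (R * R * R)%type.

Section Sol.
Context {R : realType}.
Implicit Types p q : sol R.

Definition sol_mul p q : sol R :=
  (q.1.1 + p.1.1 * expR (- q.2), q.1.2 + p.1.2 * expR q.2, q.2 + p.2).

Definition sol_one : sol R := (0, 0, 0).

Definition sol_inv p : sol R :=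
  (- p.1.1 * expR p.2, - p.1.2 * expR (- p.2), - p.2).

Lemma sol_mulA p q s : sol_mul (sol_mul p q) s = sol_mul p (sol_mul q s).
Proof.
rewrite /sol_mul /= opprD !expRD.
by congr (_, _, _); ring.
Qed.

Lemma sol_mul1 p : sol_mul p sol_one = p.
Proof.
by case: p => -[a b] c; rewrite /sol_mul /= oppr0 expR0 !mulr1 !add0r.
Qed.

Lemma sol_mulV p : sol_mul p (sol_inv p) = sol_one.
Proof.
by case: p => -[a b] c; rewrite /sol_mul /sol_one /= opprK !mulNr !addNr.
Qed.

Definition sol_subgroup (H : set (sol R)) : Prop :=
  [/\ H sol_one, forall p q, H p -> H q -> H (sol_mul p q)
    & forall p, H p -> H (sol_inv p)].

Definition base_plane : set (sol R) := [set p | p.2 = 0].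

(* The Riemannian volume of e^{2z}dx^2 + e^{-2z}dy^2 + dz^2 is dx dy dz. *)
Definition sol_volume (A : set (sol R)) : \bar R :=
  ((@lebesgue_measure R \x @lebesgue_measure R) \x @lebesgue_measure R)%E A.

Definition inf_cylinder (r : R) : set (sol R) :=
  [set p | p.1.1 ^+ 2 + p.1.2 ^+ 2 <= r ^+ 2].

Definition sol_translate (A : set (sol R)) (tau : sol R) : set (sol R) :=
  [set sol_mul p tau | p in A].

Definition bounded_cylinder (r h : R) : set (sol R) :=
  [set p | inf_cylinder r p /\ 0 <= p.2 <= h].

Section Lattice.
Variables (t1 t2 : R) (N : int).

Definition lattice_height : R :=
  ln ((N%:~R + Num.sqrt (N%:~R ^+ 2 - 4)) / 2).

Definition tau1 : sol R := (t1, t2, 0).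
Definition tau2 : sol R :=
  (t1 * expR (- lattice_height), t2 * expR lattice_height, 0).
Definition tau3 : sol R := (0, 0, lattice_height).

Definition fundamental_lattice : set (sol R) :=
  smallest sol_subgroup [set tau1; tau2; tau3].

Definition base_lattice : set (sol R) :=
  [set p | exists m n : int, p = tau1 *~ m + tau2 *~ n].

Definition base_parallelogram : set (sol R) :=
  [set p | exists s t : R,
    [/\ 0 <= s <= 1, 0 <= t <= 1 & p = s *: tau1 + t *: tau2]].

(* The vertical prism of height h over the base parallelogram.  The elements of
   base_lattice act on the right as Euclidean translations at every level z, so
   this is a fundamental domain, of volume h * Area(base_parallelogram). *)
Definition fundamental_parallelepiped : set (sol R) :=
  [set p | base_parallelogram (p.1, 0) /\ 0 <= p.2 <= lattice_height].

Definition cylinder_packing (r : R) : Prop :=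
  forall tau tau', base_lattice tau -> base_lattice tau' -> tau <> tau' ->
    (sol_translate (inf_cylinder r) tau)° `&`
    (sol_translate (inf_cylinder r) tau')° = set0.

Definition cylinder_covering (r : R) : Prop :=
  \bigcup_(tau in base_lattice) sol_translate (inf_cylinder r) tau = setT.

(* The volumes are in \bar R; both are finite, and the denominator is nonzero
   when t1, t2 <> 0 and N >= 3. *)
Definition cylinder_density (r : R) : R :=
  fine (sol_volume (bounded_cylinder r lattice_height)) /
  fine (sol_volume fundamental_parallelepiped).

End Lattice.
End Sol.

Section LatticeTheory.
Variables (R : realType) (t1 t2 : R) (N : int).
Hypothesis N_ge3 : 3 <= N.
Let h : R := lattice_height N.

Lemma lattice_height_trace :
  expR (lattice_height N) + expR (- lattice_height N) = N%:~R :> R.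
Proof.
have N3 : 3 <= N%:~R :> R by rewrite (_ : 3 = 3%:~R) // ler_int.
have D0 : 0 <= (N%:~R : R) ^+ 2 - 4 by nra.
have := sqr_sqrtr D0; have := sqrtr_ge0 ((N%:~R : R) ^+ 2 - 4).
rewrite expRN /lattice_height; set s := Num.sqrt _ => s0 sE.
by rewrite lnK ?posrE; [field: sE; lra|lra].
Qed.

Let stable (u : R -> R) := forall m n : int, exists m' n' : int,
  forall e : R, (e = h \/ e = - h) ->
  (m%:~R + n%:~R * expR e) * u e = m'%:~R + n'%:~R * expR e.

Let stable_exp (k : int) : stable (fun e => expR (k%:~R * e)).
Proof.
have sM u v : stable u -> stable v -> stable (fun e => u e * v e).
  move=> su sv m n; have [m1 [n1 E1]] := su m n.
  have [m2 [n2 E2]] := sv m1 n1; exists m2, n2 => e he.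
  by rewrite mulrA E1 // E2.
have tr e : e = h \/ e = - h -> expR e + expR (- e) = N%:~R :> R.
  by case=> ->; rewrite ?opprK -lattice_height_trace // addrC.
have ee e : expR e * expR (- e) = 1 :> R by rewrite -expRD subrr expR0.
have s1 : stable expR.
  move=> m n; exists (- n), (m + n * N) => e /tr trE.
  by rewrite !rmorphN !rmorphD !rmorphM /= -trE; ring: (ee e).
have sN1 : stable (fun e => expR (- e)).
  move=> m n; exists (m * N + n), (- m) => e /tr trE.
  by rewrite !rmorphN !rmorphD !rmorphM /= -trE; ring: (ee e).
have snat (j : nat) : stable (fun e => expR (j%:R * e)) /\
                      stable (fun e => expR (- j%:R * e)).
  elim: j => [|j [IH1 IH2]].
    by split=> m n; exists m, n => e _; rewrite ?oppr0 mul0r expR0 mulr1.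
  split=> m n.
    have [m' [n' E]] := sM _ _ IH1 s1 m n; exists m', n' => e he.
    rewrite -(E e he) -expRD; congr (_ * expR _); rewrite -natr1; ring.
  have [m' [n' E]] := sM _ _ IH2 sN1 m n; exists m', n' => e he.
  rewrite -(E e he) -expRD; congr (_ * expR _); rewrite -natr1; ring.
case: k => j; first exact: (snat j).1.
move=> m n; have [m' [n' E]] := (snat j.+1).2 m n; exists m', n' => e he.
by rewrite -(E e he) NegzE mulrNz.
Qed.

Let coords (m n k : int) : sol R :=
  (t1 * (m%:~R + n%:~R * expR (- h)), t2 * (m%:~R + n%:~R * expR h),
   k%:~R * h).

Let base_coords m n : tau1 t1 t2 *~ m + tau2 t1 t2 N *~ n = coords m n 0.
Proof.
have zE (x : sol R) (i : int) :
    x *~ i = (x.1.1 *~ i, x.1.2 *~ i, x.2 *~ i).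
  have nE (j : nat) : x *+ j = (x.1.1 *+ j, x.1.2 *+ j, x.2 *+ j).
    elim: j => [//|j IH]; rewrite !mulrS IH; by case: x {IH} => -[].
  by case: i => j; rewrite ?NegzE ?mulrNz -!pmulrn nE.
rewrite !zE /coords /tau1 /tau2 -/h mul0rz mul0r.
congr (_, _, _) => /=; last by rewrite !mul0rz addr0.
- by rewrite -(mulrzr t1) -(mulrzr (t1 * _)); ring.
- by rewrite -(mulrzr t2) -(mulrzr (t2 * _)); ring.
Qed.

Let coords_group : sol_subgroup [set p | exists m n k, p = coords m n k].
Proof.
have act m n k : exists m' n' : int,
    t1 * (m%:~R + n%:~R * expR (- h)) * expR (- (k%:~R * h)) =
      t1 * (m'%:~R + n'%:~R * expR (- h)) /\
    t2 * (m%:~R + n%:~R * expR h) * expR (k%:~R * h) =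
      t2 * (m'%:~R + n'%:~R * expR h).
  have [m' [n' E]] := stable_exp k m n; exists m', n'.
  rewrite -mulrN -!mulrA (E (- h)) ?(E h) //; first by left.
  by right.
split=> [|p q|p].
- exists 0, 0, 0; rewrite /coords /sol_one.
  by congr (_, _, _); ring.
- move=> [m [n [k ->]]] [m' [n' [k' ->]]].
  have [a [b [E1 E2]]] := act m n k'.
  exists (m' + a), (n' + b), (k' + k).
  rewrite /sol_mul /coords /= E1 E2 !rmorphD /=.
  by congr (_, _, _); ring.
- move=> [m [n [k ->]]].
  have [a [b [E1 E2]]] := act (- m) (- n) (- k).
  exists a, b, (- k).
  rewrite /sol_inv /coords /= -E1 -E2 !rmorphN /= !mulNr opprK.
  by congr (_, _, _); ring.
Qed.

Lemma base_latticeE :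
  base_lattice t1 t2 N = fundamental_lattice t1 t2 N `&` @base_plane R.
Proof.
apply/seteqP; split=> p.
  move=> [m [n ->]]; split; last first.
    by rewrite base_coords /base_plane /coords /= mul0r.
  move=> H [[H1 HM HV] Hgen].
  have HD q s : q.2 = 0 -> s.2 = 0 -> H q -> H s -> H (q + s).
    case: q s => [[a b] c] [[a' b'] c'] /= -> -> Hq Hs.
    have := HM _ _ Hs Hq; rewrite /sol_mul /= oppr0 expR0 !mulr1.
    by [].
  have HN q : q.2 = 0 -> H q -> H (- q).
    case: q => [[a b] c] /= -> Hq.
    have := HV _ Hq; rewrite /sol_inv /= oppr0 expR0 !mulr1.
    by rewrite -[X in H (_, X)]oppr0.
  have HX q (j : nat) : q.2 = 0 -> H q -> (q *+ j).2 = 0 /\ H (q *+ j).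
    move=> q0 Hq; elim: j => [//|j [IH1 IH2]].
    rewrite mulrS; split; last exact: HD.
    by rewrite -[LHS]/(q.2 + (q *+ j).2) q0 IH1 addr0.
  have HZ q (i : int) : q.2 = 0 -> H q -> (q *~ i).2 = 0 /\ H (q *~ i).
    move=> q0 Hq; case: i => j; first exact: HX.
    have [E1 E2] := HX q j.+1 q0 Hq.
    split; last exact: HN.
    by rewrite -[LHS]/(- (q *+ j.+1).2) E1 oppr0.
  have [E1 E2] : (tau1 t1 t2 *~ m).2 = 0 /\ H (tau1 t1 t2 *~ m).
    by apply: HZ => //; apply: Hgen; left; left.
  have [E3 E4] : (tau2 t1 t2 N *~ n).2 = 0 /\ H (tau2 t1 t2 N *~ n).
    by apply: HZ => //; apply: Hgen; left; right.
  exact: HD.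
move=> [Gp p0].
have [m [n [k pE]]] : [set p | exists m n k, p = coords m n k] p.
  apply: Gp; split; first exact: coords_group.
  move=> q [[]|] ->.
  - exists 1, 0, 0; rewrite /coords /tau1.
    by congr (_, _, _); ring.
  - exists 0, 1, 0; rewrite /coords /tau2.
    by congr (_, _, _); rewrite -/h; ring.
  - exists 0, 0, 1; rewrite /coords /tau3.
    by congr (_, _, _); rewrite -/h; ring.
exists m, n; rewrite base_coords.
by move: p0; rewrite pE /base_plane /coords /= mul0r => ->.
Qed.

End LatticeTheory.

(* Main.v *)
Require Import Defs.
From mathcomp Require Import all_boot all_order all_algebra.
From mathcomp Require Import all_classical all_reals all_analysis.
From mathcomp Require Import measurable_realfun ring lra zify.
Import Order.TTheory GRing.Theory Num.Theory.
Import numFieldNormedType.Exports.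
Set Implicit Arguments.
Unset Strict Implicit.
Unset Printing Implicit Defensive.
Local Open Scope classical_set_scope.
Local Open Scope ring_scope.

(* Right translation by a base-plane vector is a Euclidean translation at every
   level z, so everything reduces to a planar lattice of covolume D.  Minimizing
   |u|^2 + |v|^2 over its bases gives a basis with 0 <= 2 u.v <= |u|^2, |v|^2.
   Packing: |u|, |v| >= 2r give 4 D^2 >= 3 |u|^2 |v|^2 >= 48 r^4.  Covering: the
   circumcentre of the nonobtuse triangle 0, u, v is at distance at least its
   circumradius from the lattice, so r bounds the circumradius, and a triangle
   of circumradius at most r has area at most (3 sqrt 3 / 4) r^2. *)

(** * Reduction of binary quadratic forms *)

(** Completing the square gives C q = x^2 (AC - B^2) + (Bx + Cy)^2, and symmetrically with A. This
    confines integer vectors of bounded q to a finite box. *)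
Lemma binary_form_bound (R : realType) (A B C x y : R) :
  0 < A -> 0 < A * C - B ^+ 2 ->
  x ^+ 2 * (A * C - B ^+ 2) <= C * (A * x ^+ 2 + 2 * B * x * y + C * y ^+ 2) /\
  y ^+ 2 * (A * C - B ^+ 2) <= A * (A * x ^+ 2 + 2 * B * x * y + C * y ^+ 2).
Proof.
move=> A0 D0; rewrite -[leLHS]addr0 -[X in _ /\ X <= _]addr0; split.
  rewrite [leRHS](_ : _ = x ^+ 2 * (A * C - B ^+ 2) + (B * x + C * y) ^+ 2);
    last by ring.
  by rewrite lerD2l sqr_ge0.
rewrite [leRHS](_ : _ = y ^+ 2 * (A * C - B ^+ 2) + (A * x + B * y) ^+ 2);
  last by ring.
by rewrite lerD2l sqr_ge0.
Qed.

Lemma int_bound_of_sqr (R : realType) (K : nat) (m : int) :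
  m%:~R ^+ 2 <= K%:R :> R -> - (K%:Z) <= m <= K%:Z.
Proof.
rewrite (_ : K%:R = (K%:Z)%:~R :> R) // -rmorphXn /= ler_int => mK; nia.
Qed.

(** The standard basis has value A + C, and any competitor with no larger value has its entries in a
    finite box, so the minimum is taken over a finite type. *)
Lemma unimodular_minimum (R : realType) (A B C : R)
    (q := fun x y : int =>
       A * x%:~R ^+ 2 + 2 * B * x%:~R * y%:~R + C * y%:~R ^+ 2) :
  0 < A -> 0 < A * C - B ^+ 2 ->
  exists a b c d : int, (a * d - b * c) ^+ 2 = 1 /\
    forall a' b' c' d' : int, (a' * d' - b' * c') ^+ 2 = 1 ->
      q a b + q c d <= q a' b' + q c' d'.
Proof.
move=> A0 D0.
have C0 : 0 < C by nra.
(* If q x y <= A + C, then x^2 (AC - B^2) <= C (A + C) <= (A + C)^2, so x^2 < K and |x| <= K;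
   likewise for y. The successor gives K >= 1, so the box contains the standard basis. *)
pose K := (Num.truncn ((A + C) ^+ 2 / (A * C - B ^+ 2))).+1.
have KE : (A + C) ^+ 2 / (A * C - B ^+ 2) < K%:R by rewrite /K truncnS_gt.
have q0 x y : 0 <= q x y.
  have [h _] := binary_form_bound x%:~R y%:~R A0 D0.
  rewrite -(pmulr_rge0 _ C0); apply: le_trans h.
  by rewrite mulr_ge0 ?sqr_ge0 ?ltW.
have box x y : q x y <= A + C ->
    (- (K%:Z) <= x <= K%:Z) && (- (K%:Z) <= y <= K%:Z).
  move=> qx; have [h1 h2] := binary_form_bound x%:~R y%:~R A0 D0.
  move: KE; rewrite ltr_pdivrMr // => KE.
  apply/andP; split; apply: (@int_bound_of_sqr R); rewrite -(ler_pM2r D0).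
    apply: (le_trans h1); apply: le_trans (ltW KE).
    by rewrite expr2; apply: ler_pM; [lra|exact: q0|lra|exact: qx].
  apply: (le_trans h2); apply: le_trans (ltW KE).
  by rewrite expr2; apply: ler_pM; [lra|exact: q0|lra|exact: qx].
pose I := 'I_(2 * K + 1).
pose z (i : I) : int := i%:Z - K%:Z.
have zP (x : int) : - (K%:Z) <= x <= K%:Z -> exists i : I, z i = x.
  move=> xK; have lt : (absz (x + K%:Z)%R < 2 * K + 1)%N by lia.
  by exists (Ordinal lt); rewrite /z /=; lia.
have [i0 z0] : exists i : I, z i = 0 by apply: zP; lia.
have [i1 z1] : exists i : I, z i = 1 by apply: zP; rewrite /K; lia.
pose P (t : I * I * (I * I)) :=
  ((z t.1.1 * z t.2.2 - z t.1.2 * z t.2.1) ^+ 2 == 1).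
pose F (t : I * I * (I * I)) := q (z t.1.1) (z t.1.2) + q (z t.2.1) (z t.2.2).
have P1 : P ((i1, i0), (i0, i1)) by rewrite /P /= z0 z1.
have F1 : F ((i1, i0), (i0, i1)) = A + C by rewrite /F /q /= z0 z1; ring.
have : exists t, P t /\ forall t', P t' -> F t <= F t'.
  by case: (arg_minP F P1) => t Pt tmin; exists t.
case=> -[[a b] [c d]] [/eqP Pt tmin].
exists (z a), (z b), (z c), (z d); split=> // a' b' c' d' det'.
(* A smaller competitor would have total at most A + C; as q >= 0, both its vectors lie in the box,
   against minimality there. *)
rewrite leNgt; apply/negP => lt.
have le1 : q a' b' + q c' d' <= A + C.
  by apply: (le_trans (ltW lt)); rewrite -F1; exact: (tmin _ P1).
have /andP[/zP[ia Ea] /zP[ib Eb]] :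
    (- (K%:Z) <= a' <= K%:Z) && (- (K%:Z) <= b' <= K%:Z).
  by apply: box; have := q0 c' d'; lra.
have /andP[/zP[ic Ec] /zP[id Ed]] :
    (- (K%:Z) <= c' <= K%:Z) && (- (K%:Z) <= d' <= K%:Z).
  by apply: box; have := q0 a' b'; lra.
have := tmin ((ia, ib), (ic, id)).
rewrite /P /F /= Ea Eb Ec Ed => /(_ (introT eqP det')).
by rewrite leNgt lt.
Qed.

(** [p] is the polar form of [q]. Replacing one vector of a minimal basis by its sum or difference
    with the other preserves the squared determinant, so minimality forces 2 |p| <= q on both
    vectors. *)
Lemma reduced_basis (R : realType) (A B C : R)
    (q := fun x y : int =>
       A * x%:~R ^+ 2 + 2 * B * x%:~R * y%:~R + C * y%:~R ^+ 2)
    (p := fun x y x' y' : int => A * x%:~R * x'%:~R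
       + B * (x%:~R * y'%:~R + y%:~R * x'%:~R) + C * y%:~R * y'%:~R) :
  0 < A -> 0 < A * C - B ^+ 2 ->
  exists a b c d : int, [/\ (a * d - b * c) ^+ 2 = 1, 0 <= p a b c d,
    2 * p a b c d <= q a b & 2 * p a b c d <= q c d].
Proof.
move=> A0 D0; have [a [b [c [d [det min]]]]] := unimodular_minimum A0 D0.
have h1 : q a b + q c d <= q a b + q (c + a) (d + b).
  by apply: min; rewrite -det; ring.
have h2 : q a b + q c d <= q a b + q (c - a) (d - b).
  by apply: min; rewrite -det; ring.
have h3 : q a b + q c d <= q (a + c) (b + d) + q c d.
  by apply: min; rewrite -det; ring.
have h4 : q a b + q c d <= q (a - c) (b - d) + q c d.
  by apply: min; rewrite -det; ring.
have qD x y x' y' : q (x + x') (y + y') = q x y + 2 * p x y x' y' + q x' y'.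
  by rewrite /q /p !rmorphD /=; ring.
have qB x y x' y' : q (x - x') (y - y') = q x y - 2 * p x y x' y' + q x' y'.
  by rewrite /q /p !rmorphB /=; ring.
have pC : p c d a b = p a b c d by rewrite /p; ring.
rewrite !qD ?pC in h1 h3; rewrite !qB ?pC in h2 h4.
have [p0|p0] := leP 0 (p a b c d).
  by exists a, b, c, d; split=> //; lra.
(* Negating the second vector changes the sign of [p] and keeps both values of [q]. *)
have qN : q (- c) (- d) = q c d by rewrite /q !rmorphN /=; ring.
have pN : p a b (- c) (- d) = - p a b c d by rewrite /p !rmorphN /=; ring.
exists a, b, (- c), (- d); rewrite -/(q _ _) -/(q _ _) -/(p _ _ _ _) qN pN.
split; [by rewrite -det; ring|lra|lra|lra].
Qed.

(* With x, y, z = 2B, 2A - 2B, 2C - 2B this is the inequality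
   64 (xy + yz + zx)^3 <= 27 ((x + y) (y + z) (z + x))^2, which follows from
   8 (x + y + z) (xy + yz + zx) <= 9 (x + y) (y + z) (z + x). *)
Lemma nonobtuse_circumradius (R : realType) (A B C : R) :
  0 <= B -> 2 * B <= A -> 2 * B <= C ->
  64 * (A * C - B ^+ 2) ^+ 3 <= 27 * (A * C * (A + C - 2 * B)) ^+ 2.
Proof.
move=> B0 BA BC.
pose x := 2 * B; pose y := 2 * A - 2 * B; pose z := 2 * C - 2 * B.
have x0 : 0 <= x by rewrite /x; lra.
have y0 : 0 <= y by rewrite /y; lra.
have z0 : 0 <= z by rewrite /z; lra.
pose S := x + y + z; pose Q := x * y + y * z + z * x.
pose P := (x + y) * (y + z) * (z + x).
have xy0 := mulr_ge0 x0 y0; have yz0 := mulr_ge0 y0 z0.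
have zx0 := mulr_ge0 z0 x0.
have S0 : 0 <= S by rewrite /S; lra.
have Q0 : 0 <= Q by rewrite /Q; lra.
have SQ : 3 * Q <= S ^+ 2.
  have := sqr_ge0 (x - y); have := sqr_ge0 (y - z); have := sqr_ge0 (z - x).
  rewrite /S /Q; nra.
(* The difference 9P - 8SQ equals x (y - z)^2 + y (z - x)^2 + z (x - y)^2. *)
have SQP : 8 * (S * Q) <= 9 * P.
  have := mulr_ge0 x0 (sqr_ge0 (y - z)); have := mulr_ge0 y0 (sqr_ge0 (z - x)).
  have := mulr_ge0 z0 (sqr_ge0 (x - y)).
  rewrite /S /Q /P; nra.
have SQ0 := mulr_ge0 S0 Q0.
(* The chain is 192 Q^3 <= 64 S^2 Q^2 <= 81 P^2. *)
have : (8 * (S * Q)) ^+ 2 <= (9 * P) ^+ 2 by rewrite lerXn2r ?nnegrE //; lra.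
have : 3 * Q * Q ^+ 2 <= S ^+ 2 * Q ^+ 2 by rewrite ler_wpM2r ?sqr_ge0.
rewrite (_ : A * C - B ^+ 2 = Q / 4); last by rewrite /Q /x /y /z; field.
rewrite (_ : A * C * (A + C - 2 * B) = P / 8); last by rewrite /P /x /y /z; field.
rewrite !exprMn; lra.
Qed.

(* The left-hand side is |p - m u - n v|^2 - |p|^2 for the circumcentre p of
   the nonobtuse triangle 0, u, v. *)
Lemma reduced_delaunay (R : realType) (A B C : R) (m n : int) :
  0 <= B -> 2 * B <= A -> 2 * B <= C ->
  0 <= A * (m%:~R ^+ 2 - m%:~R) + 2 * B * m%:~R * n%:~R
       + C * (n%:~R ^+ 2 - n%:~R).
Proof.
move=> B0 BA BC.
(* Integrality enters here: k^2 - k is negative for real k strictly between 0 and 1. *)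
have sqi (k : int) : 0 <= k%:~R ^+ 2 - k%:~R :> R.
  by rewrite -rmorphXn -rmorphB /= ler0z; nia.
have hm := sqi m; have hn := sqi n.
have [mn|mn] := leP 0 (m * n).
  have mn' : 0 <= m%:~R * n%:~R :> R by rewrite -rmorphM /= ler0z.
  have := mulr_ge0 B0 mn'; have : 0 <= A by lra.
  move=> /mulr_ge0/(_ hm); have : 0 <= C by lra.
  by move=> /mulr_ge0/(_ hn); lra.
(* For mn < 0 the form is split as (A - 2B)(m^2 - m) + (C - 2B)(n^2 - n) + 2B times the present sum,
   which is (m + n)^2 - (m + n) - mn. *)
have h : 0 <= (m%:~R ^+ 2 - m%:~R) + m%:~R * n%:~R + (n%:~R ^+ 2 - n%:~R) :> R.
  have mn' : m%:~R * n%:~R < 0 :> R by rewrite -rmorphM /= ltrz0.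
  by have := sqi (m + n); rewrite rmorphD /=; lra.
have hA : 0 <= (A - 2 * B) * (m%:~R ^+ 2 - m%:~R) by rewrite mulr_ge0 // subr_ge0.
have hC : 0 <= (C - 2 * B) * (n%:~R ^+ 2 - n%:~R) by rewrite mulr_ge0 // subr_ge0.
have := mulr_ge0 B0 h; nra.
Qed.

(** * Reduced bases of planar lattices; packing and covering bounds for disks *)

(** Form reduction is applied to the Gram form of the two vectors, whose discriminant is the squared
    determinant by Lagrange's identity. *)
Lemma reduced_lattice_basis (R : realType) (x1 y1 x2 y2 : R) :
  x1 * y2 - x2 * y1 != 0 ->
  exists a b c d : int,
    let ux := a%:~R * x1 + b%:~R * x2 in let uy := a%:~R * y1 + b%:~R * y2 in
    let vx := c%:~R * x1 + d%:~R * x2 in let vy := c%:~R * y1 + d%:~R * y2 in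
    [/\ (a * d - b * c) ^+ 2 = 1, 0 <= ux * vx + uy * vy,
      2 * (ux * vx + uy * vy) <= ux ^+ 2 + uy ^+ 2 &
      2 * (ux * vx + uy * vy) <= vx ^+ 2 + vy ^+ 2].
Proof.
move=> D0.
have A0 : 0 < x1 ^+ 2 + y1 ^+ 2.
  rewrite lt_neqAle addr_ge0 ?sqr_ge0 // andbT eq_sym paddr_eq0 ?sqr_ge0 //.
  rewrite !sqrf_eq0; apply: contra D0 => /andP[/eqP-> /eqP->].
  by rewrite mul0r mulr0 subrr.
have Dpos : 0 < (x1 ^+ 2 + y1 ^+ 2) * (x2 ^+ 2 + y2 ^+ 2)
              - (x1 * x2 + y1 * y2) ^+ 2.
  rewrite [ltRHS](_ : _ = (x1 * y2 - x2 * y1) ^+ 2); last by ring.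
  by rewrite exprn_even_gt0.
have [a [b [c [d [det h1 h2 h3]]]]] := reduced_basis A0 Dpos.
by exists a, b, c, d; split=> //; lra.
Qed.

Lemma hermite_plane (R : realType) (x1 y1 x2 y2 r : R) :
  x1 * y2 - x2 * y1 != 0 -> 0 < r ->
  (forall m n : int, (m != 0) || (n != 0) ->
    (2 * r) ^+ 2 <= (m%:~R * x1 + n%:~R * x2) ^+ 2
                  + (m%:~R * y1 + n%:~R * y2) ^+ 2) ->
  12 * r ^+ 4 <= (x1 * y2 - x2 * y1) ^+ 2.
Proof.
move=> D0 r0 sep.
have [a [b [c [d]]]] := reduced_lattice_basis D0.
set ux := _ + _; set uy := _ + _; set vx := _ + _; set vy := _ + _ => /=.
move=> [det B0 BA BC].
have hA : (2 * r) ^+ 2 <= ux ^+ 2 + uy ^+ 2.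
  apply: sep; rewrite -negb_and; apply/negP => /andP[/eqP a0 /eqP b0].
  by move: det; rewrite a0 b0 !mul0r subrr.
have hC : (2 * r) ^+ 2 <= vx ^+ 2 + vy ^+ 2.
  apply: sep; rewrite -negb_and; apply/negP => /andP[/eqP c0 /eqP d0].
  by move: det; rewrite c0 d0 !mulr0 subrr.
have detR : (a%:~R * d%:~R - b%:~R * c%:~R) ^+ 2 = 1 :> R.
  by rewrite -!rmorphM -rmorphB -rmorphXn /= det.
(* A unimodular change of basis preserves the Gram determinant. *)
have -> : (x1 * y2 - x2 * y1) ^+ 2 =
    (ux ^+ 2 + uy ^+ 2) * (vx ^+ 2 + vy ^+ 2) - (ux * vx + uy * vy) ^+ 2.
  by rewrite -[LHS]mul1r -detR /ux /uy /vx /vy; ring.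
move: (ux ^+ 2 + uy ^+ 2) (vx ^+ 2 + vy ^+ 2) (ux * vx + uy * vy)
  hA hC B0 BA BC => P Q S hP hQ S0 SP SQ.
have r2 : 0 <= (2 * r) ^+ 2 by exact: sqr_ge0.
have h1 : (2 * r) ^+ 2 * (2 * r) ^+ 2 <= P * Q by exact: ler_pM.
have h2 : 2 * S * (2 * S) <= P * Q by apply: ler_pM => //; lra.
lra.
Qed.

(* The circumcentre of a nonobtuse triangle 0, u, v spanned by a lattice basis
   is at distance at least the circumradius from every lattice point. *)
Lemma covering_plane (R : realType) (x1 y1 x2 y2 r : R) :
  x1 * y2 - x2 * y1 != 0 ->
  (forall px py : R, exists m n : int,
    (px - (m%:~R * x1 + n%:~R * x2)) ^+ 2
    + (py - (m%:~R * y1 + n%:~R * y2)) ^+ 2 <= r ^+ 2) ->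
  4 * (x1 * y2 - x2 * y1) ^+ 2 <= 27 * r ^+ 4.
Proof.
move=> D0 cov.
have [a [b [c [d]]]] := reduced_lattice_basis D0.
set ux := _ + _; set uy := _ + _; set vx := _ + _; set vy := _ + _ => /=.
move=> [det B0 BA BC].
pose e : R := a%:~R * d%:~R - b%:~R * c%:~R.
have e2 : e ^+ 2 = 1 by rewrite /e -!rmorphM -rmorphB -rmorphXn /= det.
set D := x1 * y2 - x2 * y1 in D0 *.
pose E := ux * vy - uy * vx.
have EE : E = e * D by rewrite /E /e /D /ux /uy /vx /vy; ring.
have E2 : E ^+ 2 = D ^+ 2 by rewrite EE exprMn e2 mul1r.
have E0 : E != 0 by rewrite -sqrf_eq0 E2 sqrf_eq0.
pose P := ux ^+ 2 + uy ^+ 2; pose Q := vx ^+ 2 + vy ^+ 2.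
pose S := ux * vx + uy * vy.
(* The circumcentre of 0, u, v: Cramer's rule for p.u = |u|^2 / 2 and p.v = |v|^2 / 2. *)
pose px := (P * vy - Q * uy) / (2 * E); pose py := (Q * ux - P * vx) / (2 * E).
have pu : px * ux + py * uy = P / 2 by rewrite /px /py /E; field; rewrite -/E.
have pv : px * vx + py * vy = Q / 2 by rewrite /px /py /E; field; rewrite -/E.
(* The squared circumradius, |u|^2 |v|^2 |u - v|^2 / (4 D^2). *)
have pp : px ^+ 2 + py ^+ 2 = P * Q * (P + Q - 2 * S) / (4 * D ^+ 2).
  by rewrite -E2 /px /py /P /Q /S; field.
have [m [n h]] := cov px py.
(* Since [ei] is 1 or -1, it is its own inverse; [k] and [l] are the coordinates in the basis u, v
   of the lattice point covering the circumcentre. *)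
pose ei := a * d - b * c.
pose k := ei * (m * d - n * c); pose l := ei * (n * a - m * b).
have km : k * a + l * c = m.
  by rewrite -[RHS]mul1r -det /k /l /ei; ring.
have ln : k * b + l * d = n.
  by rewrite -[RHS]mul1r -det /k /l /ei; ring.
have wx : m%:~R * x1 + n%:~R * x2 = k%:~R * ux + l%:~R * vx.
  by rewrite -km -ln /ux /vx !rmorphD !rmorphM /=; ring.
have wy : m%:~R * y1 + n%:~R * y2 = k%:~R * uy + l%:~R * vy.
  by rewrite -km -ln /uy /vy !rmorphD !rmorphM /=; ring.
have del := reduced_delaunay k l B0 BA BC.
have pr : px ^+ 2 + py ^+ 2 <= r ^+ 2.
  apply: le_trans h; rewrite wx wy -subr_ge0.
  apply: (le_trans del); rewrite le_eqVlt; apply/orP; left; apply/eqP.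
  have -> : (px - (k%:~R * ux + l%:~R * vx)) ^+ 2 +
      (py - (k%:~R * uy + l%:~R * vy)) ^+ 2 - (px ^+ 2 + py ^+ 2) =
    - 2 * k%:~R * (px * ux + py * uy) - 2 * l%:~R * (px * vx + py * vy)
    + (k%:~R * ux + l%:~R * vx) ^+ 2 + (k%:~R * uy + l%:~R * vy) ^+ 2 by ring.
  by rewrite pu pv /P /Q; field.
have D2 : 0 < D ^+ 2 by rewrite exprn_even_gt0.
have PQS : P * Q - S ^+ 2 = D ^+ 2 by rewrite -E2 /P /Q /S /E; ring.
have W := nonobtuse_circumradius B0 BA BC.
rewrite -/P -/Q -/S PQS in W.
rewrite pp ler_pdivrMr in pr; last by rewrite mulr_gt0.
have P0 : 0 <= P by rewrite addr_ge0 ?sqr_ge0.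
have Q0 : 0 <= Q by rewrite addr_ge0 ?sqr_ge0.
have X0 : 0 <= P * Q * (P + Q - 2 * S).
  rewrite mulr_ge0 ?mulr_ge0 //; move: B0 BA BC; rewrite -/S -/P -/Q; lra.
have X2 : (P * Q * (P + Q - 2 * S)) ^+ 2 <= (r ^+ 2 * (4 * D ^+ 2)) ^+ 2.
  by rewrite lerXn2r ?nnegrE // (le_trans X0).
(* With X = PQ (P + Q - 2S), the bounds X^2 <= 16 r^4 D^4 and 64 D^6 <= 27 X^2 give the claim
   multiplied by 16 D^4. *)
have D4 : 0 < 16 * (D ^+ 2) ^+ 2 by rewrite mulr_gt0 // exprn_gt0.
rewrite -(ler_pM2r D4).
move: X2 W; move: (P * Q * _) (D ^+ 2) => X d2 X2 W.
rewrite !exprMn in X2; lra.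
Qed.

(** * Areas and volumes *)

(** The substitution x = r sin t turns the chord length into the integrand 2 r^2 cos^2 t, with
    antiderivative r^2 (t + sin t cos t). *)
Lemma integral_half_disk (R : realType) (r : R) : 0 < r ->
  (\int[@lebesgue_measure R]_(x in `[(- r)%R, r]) (2 * Num.sqrt (r ^+ 2 - x ^+ 2))%:E
   = (pi * r ^+ 2)%:E)%E.
Proof.
move=> r0.
have pi20 : - (pi / 2) < pi / 2 :> R by rewrite gtrN // divr_gt0 ?pi_gt0.
pose F (x : R) : R := r * sin x.
have dF x : is_derive x (1 : R) F (r * cos x).
  exact: is_derive_eq.
have F'E : derive1 F = fun x => r * cos x.
  by apply/funext => x; rewrite derive1E; apply: derive_val.
have cF : continuous F.
  by move=> x; apply/differentiable_continuous/derivable1_diffP; case: (dF x).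
have ccos : continuous (fun x : R => r * cos x).
  by move=> x; apply: cvgM; [exact: cvg_cst|exact: continuous_cos].
have LR (G : R -> R) (dG : forall x, derivable G x 1) (a b : R) :
    derivable_oo_LRcontinuous G a b.
  have cG : continuous G.
    by move=> x; exact/differentiable_continuous/derivable1_diffP.
  by split=> [x _||]; [exact: dG|apply: cvg_at_right_filter; exact: cG|
    apply: cvg_at_left_filter; exact: cG].
have Fb : F (pi / 2) = r by rewrite /F sin_pihalf mulr1.
have Fa : F (- (pi / 2)) = - r by rewrite /F sinN sin_pihalf mulrN1.
have := @integration_by_substitution_increasing R F
  (fun x => 2 * Num.sqrt (r ^+ 2 - x ^+ 2)) (- (pi / 2)) (pi / 2) (ltW pi20).
rewrite Fa Fb => ->.
- transitivity (\int[@lebesgue_measure R]_(x in `[(- (pi / 2))%R, (pi / 2)%R])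
     (2 * r ^+ 2 * cos x ^+ 2)%:E)%E.
    apply: eq_integral => x; rewrite inE /= in_itv /= => xI.
    rewrite F'E; congr (_%:E).
    transitivity (2 * Num.sqrt (r ^+ 2 - F x ^+ 2) * (r * cos x)) => //.
    rewrite /F.
    have c0 : 0 <= cos x by apply: cos_ge0_pihalf.
    rewrite (_ : r ^+ 2 - _ = (r * cos x) ^+ 2); last first.
      by rewrite !exprMn sin2cos2; ring.
    rewrite sqrtr_sqr ger0_norm; last by rewrite mulr_ge0 // ltW.
    by ring.
  pose H (x : R) := r ^+ 2 * (x + sin x * cos x).
  have dH x : is_derive x (1 : R) H (2 * r ^+ 2 * cos x ^+ 2).
    rewrite /H; apply: is_derive_eq.
    rewrite /GRing.scale /= mulrN -!expr2 sin2cos2; ring.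
  rewrite (@continuous_FTC2 R _ H) //.
  + rewrite /H sinN cosN sin_pihalf cos_pihalf -EFinB; congr (_%:E).
    by field.
  + apply: continuous_subspaceT => x.
    by apply: cvgM; [exact: cvg_cst|apply: cvgM; exact: continuous_cos].
  + by apply: LR => x; case: (dH x).
  + by move=> x _; rewrite derive1E; apply: derive_val.
- by move=> x y xI yI xy; rewrite /F ltr_pM2l // ltr_sin.
- by move=> x _; rewrite F'E; exact: ccos.
- rewrite F'E; apply/cvg_ex; exists (r * cos (- (pi / 2))).
  by apply: cvg_at_right_filter; exact: ccos.
- rewrite F'E; apply/cvg_ex; exists (r * cos (pi / 2)).
  by apply: cvg_at_left_filter; exact: ccos.
- by apply: LR => x; case: (dF x).
- apply: continuous_subspaceT => x.
  apply: cvgM; first exact: cvg_cst.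
  apply: continuous_comp; last exact: sqrt_continuous.
  by apply: cvgB; [exact: cvg_cst|exact: exprn_continuous].
Qed.

(** The pushforward of Lebesgue measure scaled by 1/|k| agrees with Lebesgue measure on half-open
    intervals, hence everywhere by uniqueness. *)
Lemma lebesgue_measure_affine_preimage (R : realType) (c k : R) (A : set R) :
  k != 0 -> measurable A ->
  (lebesgue_measure ((fun y : R => ((y - c) / k)%R) @^-1` A)
   = `|k|%:E * lebesgue_measure A)%E.
Proof.
move=> k0 mA.
pose f (y : measurableTypeR R) : measurableTypeR R := (y - c) / k.
have mf : measurable_fun setT f.
  apply: measurable_funM; last exact: measurable_cst.
  by apply: measurable_funB; [exact: measurable_id|exact: measurable_cst].
have nk : 0 <= `|k|^-1 by rewrite invr_ge0.
pose m' := mscale (NngNum nk) (pushforward (@lebesgue_measure R) f).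
pose m := m' mf.
have mE X : m X = (`|k|^-1%:E * lebesgue_measure (f @^-1` X))%E by [].
have E : lebesgue_measure A = m A.
  apply: lebesgue_measure_unique mA => // _ [[a b]] _ <-.
  transitivity (m `]a, b]%classic); last by [].
  rewrite mE.
  have [kp|kn] : 0 < k \/ k < 0 by move: k0; rewrite neq_lt => /orP[]; tauto.
    rewrite (_ : _ @^-1` _ = `](k * a + c), (k * b + c)]%classic); last first.
      apply/seteqP; split=> y /=; rewrite !in_itv /= /f;
        by rewrite ltr_pdivlMr // ler_pdivrMr // ltrBrDr lerBlDr ![_ * k]mulrC.
    rewrite !lebesgue_measure_itv /= !lte_fin ltrD2r ltr_pM2l //.
    case: ifP => _; last by rewrite mule0.
    rewrite -!EFinD -EFinM (gtr0_norm kp); congr (_%:E); field.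
    by rewrite gt_eqF.
  (* For k < 0 the map reverses order, so the closed end moves to the left. *)
  rewrite (_ : _ @^-1` _ = `[(k * b + c), (k * a + c)[%classic); last first.
    apply/seteqP; split=> y /=; rewrite !in_itv /= /f;
      by rewrite ltr_ndivlMr // ler_ndivrMr // ltrBlDr lerBrDr ![_ * k]mulrC andbC.
  rewrite !lebesgue_measure_itv /= !lte_fin ltrD2r ltr_nM2l //.
  case: ifP => _; last by rewrite mule0.
  rewrite -!EFinD -EFinM (ltr0_norm kn); congr (_%:E); field.
  by rewrite lt_eqF.
rewrite E mE muleA -EFinM divff ?normr_eq0 // mul1e.
by [].
Qed.

Lemma lebesgue_measure_linear_interval (R : realType) (k c : R) : k != 0 ->
  lebesgue_measure [set y : R | 0 <= (y - c) / k <= 1] = `|k|%:E.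
Proof.
move=> k0; have := lebesgue_measure_affine_preimage c k0 (measurable_itv `[0, 1]).
rewrite lebesgue_measure_itv /= lte_fin ltr01 -EFinB subr0 mule1 => <-.
by congr lebesgue_measure; apply/seteqP; split=> y /=; rewrite in_itv.
Qed.

Lemma measurable_unit_preimage d (T : measurableType d) (R : realType)
    (f : T -> R) :
  measurable_fun setT f -> measurable [set x | 0 <= f x <= 1].
Proof.
move=> mf; rewrite (_ : mkset _ = setT `&` f @^-1` `[0, 1]%classic); last first.
  by rewrite setTI; apply/seteqP; split=> y /=; rewrite in_itv.
by apply: mf => //; exact: measurable_itv.
Qed.

Definition parallelogram (R : realType) (x1 y1 x2 y2 : R) : set (R * R) :=
  [set p | exists s t : R, [/\ 0 <= s <= 1, 0 <= t <= 1 &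
    p = (s * x1 + t * x2, s * y1 + t * y2)]].

(** Cramer's rule recovers s and t from the point; this form makes measurability visible. *)
Lemma parallelogramE (R : realType) (x1 y1 x2 y2 : R)
    (D := x1 * y2 - x2 * y1) : D != 0 ->
  parallelogram x1 y1 x2 y2 =
    [set p | 0 <= (p.1 * y2 - p.2 * x2) / D <= 1] `&`
    [set p | 0 <= (p.2 * x1 - p.1 * y1) / D <= 1].
Proof.
move=> D0; apply/seteqP; split=> -[x y] /=.
  move=> [s [t [hs ht [-> ->]]]]; split.
    by rewrite (_ : _ / D = s) //; rewrite /D; field.
  by rewrite (_ : _ / D = t) //; rewrite /D; field.
move=> [hs ht]; exists ((x * y2 - y * x2) / D), ((y * x1 - x * y1) / D).
by split=> //; congr pair; rewrite /D; field.
Qed.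

Lemma measurable_parallelogram (R : realType) (x1 y1 x2 y2 : R) :
  x1 * y2 - x2 * y1 != 0 -> measurable (parallelogram x1 y1 x2 y2).
Proof.
move=> D0; rewrite parallelogramE //.
by apply: measurableI; apply: measurable_unit_preimage;
  apply: measurable_funM => //; apply: measurable_funB;
  apply: measurable_funM => //.
Qed.

(* The vertical section of the parallelogram at abscissa x is an affine image
   of the set of t with 0 <= (x - t x2) / x1 <= 1; exchanging the order of
   integration leaves only intervals of length |x1|. *)
Lemma area_parallelogram (R : realType) (x1 y1 x2 y2 : R) :
  x1 != 0 -> x1 * y2 - x2 * y1 != 0 ->
  ((@lebesgue_measure R \x @lebesgue_measure R) (parallelogram x1 y1 x2 y2)
   = `|x1 * y2 - x2 * y1|%:E)%E.
Proof.
move=> x10 D0; set D := _ - _ in D0 *.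
(* Points of [T] are pairs (x, t); the first condition says that the coefficient s determined by x
   and t lies in [0, 1]. *)
pose T : set (R * R) :=
  [set p | 0 <= (p.1 - p.2 * x2) / x1 <= 1] `&` [set p | 0 <= p.2 <= 1].
have mT : measurable T.
  apply: measurableI; apply: measurable_unit_preimage => //.
  by apply: measurable_funM => //; apply: measurable_funB => //; apply: measurable_funM.
have k0 : D / x1 != 0 by rewrite mulf_neq0 // invr_eq0.
rewrite /product_measure1.
transitivity (\int[lebesgue_measure]_x
    (`|D / x1|%:E * (lebesgue_measure \o xsection T) x))%E.
  apply: eq_integral => x _.
  rewrite [RHS]/= -(lebesgue_measure_affine_preimage (x / x1 * y1) k0);
    last exact: measurable_xsection.
  congr lebesgue_measure; rewrite !xsectionE.
  apply/seteqP; split=> y /=.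
    move=> [s [t [hs ht [-> ->]]]]; rewrite (_ : _ / (D / x1) = t).
      by split=> //=; rewrite (_ : _ / x1 = s) //; field.
    by rewrite /D; field; apply/andP.
  move=> [/= hs ht]; eexists; eexists; split; [exact: hs|exact: ht|].
  by congr pair; rewrite /D /=; field => //; rewrite ?x10 ?D0 //; apply/andP.
rewrite ge0_integralZl //; last exact: measurable_fun_xsection.
rewrite (_ : integral _ _ _ = `|x1|%:E) -?EFinM -?normrM ?divfK //.
(* Uniqueness of the product measure exchanges the two iterated integrals. *)
have := @product_measure_unique _ _ _ _ R (@lebesgue_measure R) (@lebesgue_measure R)
  (@lebesgue_measure R \x^ @lebesgue_measure R)%E.
move=> /(_ _ T mT) E.
transitivity ((@lebesgue_measure R \x^ @lebesgue_measure R) T)%E.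
  by apply: E => X Y mX mY; exact: product_measure2E.
rewrite /product_measure2.
transitivity (\int[lebesgue_measure]_(t in `[0%R, 1%R]) (cst `|x1|%:E t))%E.
  rewrite [RHS]integral_mkcond; apply: eq_integral => t _ /=.
  rewrite ysectionE patchE; case: ifPn; rewrite ?inE ?notin_setE /= in_itv /= => ht.
    rewrite -(lebesgue_measure_linear_interval (t * x2) x10).
    by congr lebesgue_measure; apply/seteqP; split=> x //= [].
  rewrite (_ : _ @^-1` _ = set0) ?measure0 //.
  by apply/seteqP; split=> x //= -[].
rewrite integral_cst //= lebesgue_measure_itv /= lte_fin ltr01.
by rewrite -EFinB subr0 mule1.
Qed.

Lemma area_disk (R : realType) (r : R) : 0 < r ->
  (@lebesgue_measure R \x @lebesgue_measure R)%E
     [set p : R * R | p.1 ^+ 2 + p.2 ^+ 2 <= r ^+ 2] = (pi * r ^+ 2)%:E.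
Proof.
move=> r0; rewrite -integral_half_disk // /product_measure1.
rewrite [RHS]integral_mkcond; apply: eq_integral => x _ /=.
rewrite xsectionE patchE; case: ifPn; rewrite ?inE ?notin_setE /= in_itv /= => hx.
  have h : 0 <= r ^+ 2 - x ^+ 2 by nra.
  rewrite (_ : _ @^-1` _ =
    `[- Num.sqrt (r ^+ 2 - x ^+ 2), Num.sqrt (r ^+ 2 - x ^+ 2)]%classic).
    rewrite lebesgue_measure_itv /= lte_fin; set s := Num.sqrt _.
    have s0 : 0 <= s := sqrtr_ge0 _.
    case: ifP => hs; first by rewrite -EFinB; congr (_%:E); ring.
    by congr (_%:E); move/negbT: hs; rewrite -leNgt; lra.
  apply/seteqP; split=> y /=; rewrite in_itv /= -ler_norml -sqrtr_sqr ler_sqrt //; lra.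
rewrite (_ : _ @^-1` _ = set0) ?measure0 //.
apply/seteqP; split=> y //= hy; apply: hx.
have := sqr_ge0 y; set s := y ^+ 2 in hy * => s0; apply/andP; split; nra.
Qed.

Lemma measurable_disk (R : realType) (r : R) :
  measurable [set p : R * R | p.1 ^+ 2 + p.2 ^+ 2 <= r ^+ 2].
Proof.
rewrite -[X in measurable X]setTI; apply: measurable_fun_le => //.
by apply: measurable_funD; exact: measurable_funX.
Qed.

(** * Volumes in Sol and the density as a ratio of planar areas *)

Lemma lattice_height_gt0 (R : realType) (N : int) : 3 <= N ->
  0 < lattice_height N :> R.
Proof.
move=> N3; have N3R : 3 <= N%:~R :> R by rewrite (_ : 3 = 3%:~R) // ler_int.
rewrite /lattice_height ln_gt0 //.
by have := sqrtr_ge0 ((N%:~R : R) ^+ 2 - 4); lra.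
Qed.

(** The determinant factors as t1 t2 (e^h - e^(-h)), and h > 0. *)
Lemma base_det_neq0 (R : realType) (t1 t2 : R) (N : int)
    (h := lattice_height N) :
  t1 != 0 -> t2 != 0 -> 3 <= N ->
  t1 * (t2 * expR h) - t1 * expR (- h) * t2 != 0.
Proof.
move=> t10 t20 N3; have h0 := lattice_height_gt0 R N3.
rewrite (_ : _ - _ = t1 * t2 * (expR h - expR (- h))); last by ring.
by rewrite !mulf_neq0 // subr_eq0 gt_eqF // ltr_expR gtrN.
Qed.

Lemma sol_volume_prism (R : realType) (A : set (R * R)) (h a : R) :
  0 <= h -> measurable A ->
  (@lebesgue_measure R \x @lebesgue_measure R)%E A = a%:E ->
  sol_volume (A `*` `[0, h]%classic) = (a * h)%:E.
Proof.
move=> h0 mA aE; rewrite /sol_volume product_measure1E //=.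
rewrite aE lebesgue_measure_itv /= lte_fin.
move: h0; rewrite le_eqVlt => /predU1P[<-|h0].
  by rewrite ltxx mule0 mulr0.
by rewrite h0 -EFinB subr0.
Qed.

Lemma volume_bounded_cylinder (R : realType) (r h : R) : 0 < r -> 0 <= h ->
  sol_volume (bounded_cylinder r h) = (pi * r ^+ 2 * h)%:E.
Proof.
move=> r0 h0.
rewrite -(sol_volume_prism h0 (measurable_disk r) (area_disk r0)).
by congr sol_volume; apply/seteqP; split=> p /=; rewrite in_itv.
Qed.

Lemma volume_fundamental_parallelepiped (R : realType) (t1 t2 : R) (N : int)
    (h := lattice_height N) :
  t1 != 0 -> t2 != 0 -> 3 <= N ->
  sol_volume (fundamental_parallelepiped t1 t2 N) =
  (`|t1 * (t2 * expR h) - t1 * expR (- h) * t2| * h)%:E.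
Proof.
move=> t10 t20 N3; have h0 := lattice_height_gt0 R N3.
have D0 := base_det_neq0 t10 t20 N3.
rewrite -(sol_volume_prism (ltW h0) (measurable_parallelogram D0)
  (area_parallelogram t10 D0)).
congr sol_volume; apply/seteqP; split=> -[[x y] z] /=; rewrite in_itv /=.
  move=> [[s [t [hs ht]]]] [-> -> _] hz; split=> //; exists s, t.
  by split.
move=> [[s [t [hs ht [-> ->]]]]] hz; split=> //; exists s, t; split=> //.
congr (_, _, _).
by rewrite /= !scaler0 addr0.
Qed.

(** Both solids are prisms of the same height h > 0, which cancels. *)
Lemma cylinder_densityE (R : realType) (t1 t2 r : R) (N : int)
    (h := lattice_height N) :
  t1 != 0 -> t2 != 0 -> 3 <= N -> 0 < r ->
  cylinder_density t1 t2 N r =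
  pi * r ^+ 2 / `|t1 * (t2 * expR h) - t1 * expR (- h) * t2|.
Proof.
move=> t10 t20 N3 r0; have h0 := lattice_height_gt0 R N3.
rewrite /cylinder_density volume_bounded_cylinder ?(ltW h0) //.
rewrite volume_fundamental_parallelepiped //= -mulf_div divff ?mulr1 //.
by rewrite gt_eqF.
Qed.

(** * From cylinders in Sol to disks in the plane *)

Lemma base_lattice_coords (R : realType) (t1 t2 : R) (N m n : int)
    (h := lattice_height N) :
  tau1 t1 t2 *~ m + tau2 t1 t2 N *~ n =
  (m%:~R * t1 + n%:~R * (t1 * expR (- h)),
   m%:~R * t2 + n%:~R * (t2 * expR h), 0).
Proof.
have zE (x : sol R) (i : int) : x *~ i = (i%:~R * x.1.1, i%:~R * x.1.2, i%:~R * x.2).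
  rewrite -scaler_int; case: x => -[a b] c.
  by [].
by rewrite !zE; congr (_, _, _); rewrite /= !mulr0 addr0.
Qed.

(** The translating vector has third coordinate 0, so both exponential factors of the group law
    equal 1. *)
Lemma translate_inf_cylinder (R : realType) (r a b : R) :
  sol_translate (inf_cylinder r) (a, b, 0) =
  [set p | (p.1.1 - a) ^+ 2 + (p.1.2 - b) ^+ 2 <= r ^+ 2].
Proof.
apply/seteqP; split=> p /=.
  move=> [q hq <-]; rewrite /sol_mul /= oppr0 expR0 !mulr1.
  by rewrite ![_ + _ - _]addrAC !subrr !add0r.
case: p => -[x y] z /= hp; exists (x - a, y - b, z) => //.
by rewrite /sol_mul /= oppr0 expR0 !mulr1 add0r ![_ + (_ - _)]addrC !subrK.
Qed.

Lemma open_cylinder (R : realType) (r a b : R) :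
  open [set p : sol R | (p.1.1 - a) ^+ 2 + (p.1.2 - b) ^+ 2 < r ^+ 2].
Proof.
pose f (p : sol R) : R := (p.1.1 - a) ^+ 2 + (p.1.2 - b) ^+ 2.
have cf : continuous f.
  have sq (g : sol R -> R) c : continuous g -> continuous (fun p => (g p - c) ^+ 2).
    move=> cg p; apply: (@continuous_comp _ _ _ (fun p => g p - c) (fun x => x ^+ 2)).
      by apply: cvgB; [exact: cg|exact: cvg_cst].
    exact: exprn_continuous.
  move=> p; apply: cvgD.
    by apply: (sq (fun p => p.1.1)) => q; exact: cvg_comp cvg_fst cvg_fst.
  by apply: (sq (fun p => p.1.2)) => q; exact: cvg_comp cvg_fst cvg_snd.
rewrite (_ : mkset _ = f @^-1` [set x | x < r ^+ 2]) //.
by apply: open_comp => [p _|]; [exact: cf|exact: open_lt].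
Qed.

Lemma interior_translate_cylinder (R : realType) (r a b : R) (p : sol R) :
  (p.1.1 - a) ^+ 2 + (p.1.2 - b) ^+ 2 < r ^+ 2 ->
  (sol_translate (inf_cylinder r) (a, b, 0))° p.
Proof.
rewrite translate_inf_cylinder => hp.
have : [set q : sol R | (q.1.1 - a) ^+ 2 + (q.1.2 - b) ^+ 2 < r ^+ 2] `<=`
  [set q : sol R | (q.1.1 - a) ^+ 2 + (q.1.2 - b) ^+ 2 <= r ^+ 2]°.
  by rewrite -open_subsetE; [move=> q /=; exact: ltW|exact: open_cylinder].
exact.
Qed.

Lemma packing_separation (R : realType) (t1 t2 r : R) (N m n : int)
    (h := lattice_height N) :
  t1 * (t2 * expR h) - t1 * expR (- h) * t2 != 0 ->
  cylinder_packing t1 t2 N r -> (m != 0) || (n != 0) ->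
  (2 * r) ^+ 2 <= (m%:~R * t1 + n%:~R * (t1 * expR (- h))) ^+ 2
                + (m%:~R * t2 + n%:~R * (t2 * expR h)) ^+ 2.
Proof.
move=> D0 pack mn0.
set wx := m%:~R * t1 + _; set wy := m%:~R * t2 + _; rewrite leNgt; apply/negP => lt.
have L0 : base_lattice t1 t2 N (0, 0, 0).
  exists 0, 0; rewrite base_lattice_coords.
  by rewrite !mul0r !addr0.
have Lw : base_lattice t1 t2 N (wx, wy, 0).
  by exists m, n; rewrite base_lattice_coords.
have neq : (0, 0, 0) <> (wx, wy, 0) :> sol R.
  (* Cramer's rule again: a zero lattice vector would force m = n = 0. *)
  case=> x0 y0.
  have e1 : m%:~R * (t1 * (t2 * expR h) - t1 * expR (- h) * t2) = 0.
    rewrite [LHS](_ : _ = wx * (t2 * expR h) - wy * (t1 * expR (- h))).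
      by rewrite -x0 -y0 !mul0r subrr.
    by rewrite /wx /wy; ring.
  have e2 : n%:~R * (t1 * (t2 * expR h) - t1 * expR (- h) * t2) = 0.
    rewrite [LHS](_ : _ = wy * t1 - wx * t2).
      by rewrite -x0 -y0 !mul0r subrr.
    by rewrite /wx /wy; ring.
  move/eqP: e1; rewrite mulf_eq0 (negbTE D0) orbF intr_eq0 => m0.
  move/eqP: e2; rewrite mulf_eq0 (negbTE D0) orbF intr_eq0 => n0.
  by move: mn0; rewrite m0 n0.
(* The midpoint of 0 and a lattice vector shorter than 2r is interior to both cylinders. *)
have := pack _ _ L0 Lw neq; move/seteqP => [/(_ (wx / 2, wy / 2, 0))+ _].
by apply; split; apply: interior_translate_cylinder => /=; lra.
Qed.

(** It suffices to look at the points of Sol at height 0. *)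
Lemma covering_base_plane (R : realType) (t1 t2 r : R) (N : int)
    (h := lattice_height N) :
  cylinder_covering t1 t2 N r ->
  forall px py : R, exists m n : int,
    (px - (m%:~R * t1 + n%:~R * (t1 * expR (- h)))) ^+ 2
    + (py - (m%:~R * t2 + n%:~R * (t2 * expR h))) ^+ 2 <= r ^+ 2.
Proof.
move=> cov px py.
have : [set: sol R] (px, py, 0) by [].
rewrite -cov => -[_ [m [n ->]]].
by rewrite base_lattice_coords translate_inf_cylinder; exists m, n.
Qed.

Unset Implicit Arguments.

Theorem corollary4p10 (R : realType) (t1 t2 : R) (N : int)
    (ht1 : t1 != 0) (ht2 : t2 != 0) (hN : 3 <= N) :
  (forall r : R, 0 < r -> cylinder_packing t1 t2 N r ->
     cylinder_density t1 t2 N r <= pi / Num.sqrt 12) /\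
  (forall r : R, 0 < r -> cylinder_covering t1 t2 N r ->
     2 * pi / Num.sqrt 27 <= cylinder_density t1 t2 N r).
Proof.
have D0 := base_det_neq0 ht1 ht2 hN.
have normD2 := real_normK (num_real
  (t1 * (t2 * expR (lattice_height N)) - t1 * expR (- lattice_height N) * t2)).
split=> r r0 hr; rewrite cylinder_densityE // -mulrA.
  have := hermite_plane D0 r0 (fun m n => packing_separation D0 hr).
  rewrite -normD2; set d := `|_| => hd.
  have d0 : 0 < d by rewrite normr_gt0.
  rewrite ler_pM2l ?pi_gt0 // ler_pdivrMr // ler_pdivlMl ?sqrtr_gt0 //.
  (* The remaining goal sqrt 12 r^2 <= d is squared into the planar packing bound. *)
  rewrite -(@ler_pXn2r _ 2) ?nnegrE ?(ltW d0) ?mulr_ge0 ?sqrtr_ge0 ?(ltW r0) //.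
  by rewrite exprMn sqr_sqrtr //; lra.
have := covering_plane D0 (covering_base_plane hr).
rewrite -normD2; set d := `|_| => hd.
have d0 : 0 < d by rewrite normr_gt0.
rewrite mulrCA -[leRHS]mulrA ler_pM2l ?pi_gt0 //.
rewrite ler_pdivrMr ?sqrtr_gt0 // mulrAC ler_pdivlMr //.
(* Likewise 2 d <= r^2 sqrt 27 squares into the planar covering bound. *)
rewrite -(@ler_pXn2r _ 2) ?nnegrE ?mulr_ge0 ?(ltW d0) ?sqrtr_ge0 ?(ltW r0) //.
by rewrite !exprMn sqr_sqrtr //; lra.
Qed.
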